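(* Let a semitopological semigroup $G$ be represented on $C(K)$ by a right amenable semigroup $\mathcal S=\{S_g:g\in G\}$ of Markov operators, and let $\mathcal S$ be uniquely ergodic with invariant probability measure $\mu$. Consider the semigroups $\chi\mathcal S$ for each $\chi$ in a compact set $\Lambda\subset\widehat G$. If $\{(A_\alpha^{\chi\mathcal S})_{\alpha\in\mathcal A}:\chi\in\Lambda\}$ is a uniform family of right ergodic nets and if $f\in C(K)$ satisfies (1) $P_{\operatorname{Fix}\chi\mathcal S_2}f\in C(K)$ for each $\chi\in\Lambda$ (i.e. it has a continuous representative), (2) the map $\Lambda\to\mathbb R_+$, $\chi\mapsto\|A_\alpha^{\chi\mathcal S}f-P_\chi f\|_\infty$ is continuous for each $\alpha\in\mathcal A$, then $$\lim_\alpha\sup_{\chi\in\Lambda}\|A_\alpha^{\chi\mathcal S}f-P_\chi f\|_\infty=0.$$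
   Context: $K$ is a compact (Hausdorff) space, $C(K)$ the Banach space of complex continuous functions with the sup norm $\|\cdot\|_\infty$. $\mathscr L(C(K))$ carries the strong operator topology, in which closures are taken. $\mathbb T$ is the unit circle. A semitopological semigroup is a semigroup with a topology making multiplication separately continuous. $G$ is represented on $C(K)$ by a semigroup $\mathcal S=\{S_g:g\in G\}$ of Markov operators if each $S_g$ is a positive operator with $S_g\mathbf 1=\mathbf 1$, $S_{g_1}S_{g_2}=S_{g_2g_1}$, and $g\mapsto S_gf$ is continuous for each $f$. $\mathcal S$ is right amenable if, as a topological semigroup under composition with the strong operator topology, it has a right invariant mean: $m\in C_b(\mathcal S)'$ with $\langle m,\mathbf 1\rangle=\|m\|=1$ and $\langle m,F(\cdot\,T)\rangle=\langle m,F\rangle$ for all $T\in\mathcal S$, $F\in C_b(\mathcal S)$ (bounded continuous functions), where $F(\cdot\,T)(U)=F(UT)$. $\mathcal S$ is uniquely ergodic with invariant measure $\mu$ if $\{\nu\in C(K)':S_g'\nu=\nu\ \forall g\}=\mathbb C\cdot\mu$ with $\mu$ a probability measure. $S_{g,2}$ is the continuous extension of $S_g$ to $L^2(K,\mu)$. $\widehat G$ is the set of continuous multiplicative maps $\chi:G\to\mathbb T$, with the topology of uniform convergence on compact sets. $\chi\mathcal S=\{\chi(g)S_g:g\in G\}$, $\chi\mathcal S_2=\{\chi(g)S_{g,2}:g\in G\}$; $\operatorname{Fix}$ denotes the space of common fixed points of a set of operators; $P_{\operatorname{Fix}\chi\mathcal S_2}$ is the orthogonal projection of $L^2(K,\mu)$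 onto $\operatorname{Fix}\chi\mathcal S_2$. $P_\chi$ denotes the mean ergodic projection of $\chi\mathcal S$ on $Y_f=\overline{\operatorname{lin}}\,\chi\mathcal Sf$, i.e. the zero element of $\overline{\operatorname{co}}(\chi\mathcal S|_{Y_f})$ ($P_\chi T=TP_\chi=P_\chi$ for all $T\in\overline{\operatorname{co}}(\chi\mathcal S|_{Y_f})$); the semigroup $\chi\mathcal S$ is called mean ergodic on $Y_f$ if such an element exists, and the hypotheses are understood to provide this. $P_\chi f$ is the value at $f$ (if $f\notin Y_f$, it means $P_\chi(\chi(g)S_gf)$, which does not depend on $g\in G$). Uniform family: let $\mathcal S_i=\{S_{i,g}:g\in G\}$, $i\in I$, be representations of $G$ on $C(K)$ with $\sup_{i,g}\|S_{i,g}\|<\infty$, let $\mathcal A$ be a directed set and $(A_\alpha^{\mathcal S_i})_{\alpha\in\mathcal A}\subset\mathscr L(C(K))$ a net for each $i$. $\{(A_\alpha^{\mathcal S_i})_{\alpha\in\mathcal A}:i\in I\}$ is a uniform family of right ergodic nets if (i) for all $\alpha\in\mathcal A$, $\varepsilon>0$, $f_1,\dots,f_m\in C(K)$ there are $g_1,\dots,g_n\in G$ such that for each $i\in I$ there is a convex combination $\sum_{j=1}^nc_{i,j}S_{i,g_j}$ with $\sup_{i\in I}\|A_\alpha^{\mathcal S_i}f_k-\sum_{j}c_{i,j}S_{i,g_j}f_k\|_\infty<\varepsilon$ for all $k$; (ii) $\lim_\alpha\sup_{i\in I}\|A_\alpha^{\mathcal S_i}f-A_\alpha^{\mathcal S_i}S_{i,g}f\|_\infty=0$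 for all $g\in G$, $f\in C(K)$. Here $I=\Lambda$ and $\mathcal S_\chi=\chi\mathcal S$.
   Formalization: Existence of the mean ergodic projection P_χ on Y_f for each χ in Λ is assumed separately, because condition (1) as stated does not imply it when the support of μ is not all of K, and P_χ f is then undefined. *)

(* Defs.v *)
From HB Require Import structures.
From mathcomp Require Export all_boot all_order all_algebra.
From mathcomp Require Export all_classical all_reals all_analysis.
From mathcomp Require Export complex.

Set Implicit Arguments.
Unset Strict Implicit.
Unset Printing Implicit Defensive.

Import Order.TTheory GRing.Theory Num.Theory.
Import numFieldTopology.Exports numFieldNormedType.Exports.

Local Open Scope classical_set_scope.
Local Open Scope ring_scope.
Local Open Scope complex_scope.

(* The complex numbers, with their usual norm and topology. *)
Notation Cplx R := (R[i]^o).

HB.mixin Record isSeparatelyContinuous G of Topological G & Semigroup G := {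
  mulg_continuousl : forall x : G, continuous (fun y : G => (x * y)%g);
  mulg_continuousr : forall x : G, continuous (fun y : G => (y * x)%g)
}.

#[short(type="semitopologicalSemigroupType")]
HB.structure Definition SemitopologicalSemigroup :=
  {G of Topological G & Semigroup G & isSeparatelyContinuous G}.

(* The space of bounded continuous complex functions on X with the sup norm. On
   a compact space every continuous function is bounded (see bcfun_of_compact),
   so this one construction provides both C_b(X) and C(K). *)
Section BoundedContinuous.
Variables (R : realType) (X : topologicalType).

Definition bcont : {pred (X -> Cplx R)} :=
  mem [set f | continuous f /\ exists M : R[i], forall x, `|f x| <= M].

Record bcfunType := BCFun { bcfun :> X -> Cplx R; bcfunP : bcfun \in bcont }.

HB.instance Definition _ := [isSub for bcfun].
HB.instance Definition _ := [Choice of bcfunType by <:].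

Lemma bcont_submod_closed : submod_closed bcont.
Proof.
split.
  rewrite inE; split; first exact: cst_continuous.
  by exists 0 => x; rewrite normr0.
move=> a f g; rewrite !inE => -[cf [M fM]] [cg [N gN]]; split.
  by move=> x; apply: cvgD; [apply: cvgZr; exact: cf | exact: cg].
exists (`|a| * M + N) => x.
by rewrite (le_trans (ler_normD _ _))// lerD// normrM ler_wpM2l.
Qed.

HB.instance Definition _ := GRing.isSubmodClosed.Build _ _ bcont
  bcont_submod_closed.
HB.instance Definition _ := [SubChoice_isSubLmodule of bcfunType by <:].

Definition bcnorm (f : bcfunType) : R[i] :=
  (sup (range (fun x => complex.Re `|f x|)))%:C.

Lemma normcE (z : R[i]) : `|z| = (complex.Re `|z|)%:C.
Proof. by rewrite RRe_real// normr_real. Qed.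

Lemma Re_norm_ge0 (z : R[i]) : 0 <= complex.Re `|z|.
Proof. by rewrite -lecR -normcE normr_ge0. Qed.

Let has_ub_bcfun (f : bcfunType) :
  has_ubound (range (fun x => complex.Re `|f x|)).
Proof.
have /set_mem [_ [M fM]] := bcfunP f.
exists (complex.Re M) => _ [x _ <-].
by have := fM x; rewrite lecE => /andP[].
Qed.

Let le_sup_bcfun (f : bcfunType) x :
  complex.Re `|f x| <= sup (range (fun x => complex.Re `|f x|)).
Proof. by apply: ub_le_sup; [exact: has_ub_bcfun|exists x]. Qed.

Let sup_bcfun_le (f : bcfunType) (M : R) : 0 <= M ->
  (forall x, complex.Re `|f x| <= M) ->
  sup (range (fun x => complex.Re `|f x|)) <= M.
Proof.
move=> M0 fM; set B := range _.
have [B0|/set0P ne] := eqVneq B set0; first by rewrite B0 sup0.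
by apply: ge_sup => // _ [x _ <-].
Qed.

Let sup_bcfun_ge0 (f : bcfunType) :
  0 <= sup (range (fun x => complex.Re `|f x|)).
Proof.
set B := range _; have [B0|/set0P[_ [x _ _]]] := eqVneq B set0.
  by rewrite B0 sup0.
exact: le_trans (Re_norm_ge0 _) (le_sup_bcfun f x).
Qed.

Lemma bcnormD (f g : bcfunType) : bcnorm (f + g) <= bcnorm f + bcnorm g.
Proof.
rewrite /bcnorm -rmorphD lecR; apply: sup_bcfun_le => [|x].
  by rewrite addr_ge0.
rewrite (le_trans _ (lerD (le_sup_bcfun f x) (le_sup_bcfun g x)))//.
by rewrite -lecR rmorphD/= -!normcE ler_normD.
Qed.

Lemma bcnormZ_le (a : R[i]) (f : bcfunType) :
  bcnorm (a *: f) <= `|a| * bcnorm f.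
Proof.
rewrite /bcnorm [`|a|]normcE -rmorphM lecR; apply: sup_bcfun_le => [|x].
  by rewrite mulr_ge0// Re_norm_ge0.
rewrite (le_trans _ (ler_wpM2l (Re_norm_ge0 a) (le_sup_bcfun f x)))//.
by rewrite -lecR rmorphM/= -!normcE normrM.
Qed.

Lemma bcnorm_eq0 (f : bcfunType) : bcnorm f = 0 -> f = 0.
Proof.
move=> /(congr1 (@complex.Re R))/= f0; apply/val_inj/funext => x /=.
apply/eqP; rewrite -normr_eq0 normcE; apply/eqP; congr (_%:C).
by apply/eqP; rewrite eq_le Re_norm_ge0 andbT -[leRHS]f0.
Qed.

Lemma bcnormZ (a : R[i]) (f : bcfunType) : bcnorm (a *: f) = `|a| * bcnorm f.
Proof.
apply/eqP; rewrite eq_le bcnormZ_le/=.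
have [->|a0] := eqVneq a 0.
  by rewrite normr0 mul0r scale0r lecR sup_bcfun_ge0.
rewrite -{1}[f](scalerK a0) -ler_pdivlMl ?normr_gt0// -normfV.
exact: bcnormZ_le.
Qed.

HB.instance Definition _ := Lmodule_isNormed.Build R[i] bcfunType
  bcnormD bcnormZ bcnorm_eq0.

Lemma bcone_subproof : (cst 1 : X -> Cplx R) \in bcont.
Proof.
by rewrite inE; split; [exact: cst_continuous | exists `|1| => x].
Qed.

Definition bcone : bcfunType := BCFun bcone_subproof.

Lemma bcfun_of_compact (f : X -> Cplx R) :
  compact [set: X] -> continuous f -> exists g : bcfunType, bcfun g = f.
Proof.
move=> cX cf; suff bf : f \in bcont by exists (BCFun bf).
rewrite inE; split=> //.
have /filter_ex[M fM] : \forall M \near (+oo : set_system R[i]),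
    [set: X] `<=` [set x | `|f x| <= M].
  apply: (proj1 (compact_near_coveringP _) cX) => x _.
  exists ([set y | `|f x - f y| < 1], [set M | `|f x| + 1 <= M]) => /=.
    split; first by apply: (proj1 (cvgrPdist_lt _ _) (cf x)).
    by apply: nbhs_pinfty_ge; rewrite realD// normr_real.
  move=> [y M] [/= fxy fxM]; apply: le_trans fxM.
  rewrite -[f y](subKr (f x)) (le_trans (ler_normB _ _))// lerD2l.
  exact: ltW.
by exists M => x; exact: fM.
Qed.

End BoundedContinuous.

Notation "'C_b[' R ]( X )" := (bcfunType R X)
  (at level 8, format "'C_b[' R ]( X )").
Notation "'C[' R ]( K )" := (bcfunType R K)
  (at level 8, only parsing).
Arguments bcone {R X}.

(* Norms in a normed space over R[i] are themselves elements of R[i]. *)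
Definition rnorm (R : realType) (V : normedModType R[i]) (v : V) : R :=
  complex.Re `|v|.

Section Operators.
Variable R : realType.

Definition is_operator (V W : normedModType R[i]) (T : V -> W) :=
  linear T /\ continuous T.

Definition opnorm (V W : normedModType R[i]) (T : V -> W) : \bar R :=
  ereal_sup [set (rnorm (T v))%:E | v in [set v : V | rnorm v <= 1]].

(* The supremum is taken in [0, +oo], hence the 0, which matters only when the
   index set is empty. *)
Definition sup_norm (J : Type) (I : set J) (V : normedModType R[i]) (u : J -> V)
    : \bar R :=
  ereal_sup (0%E |` [set (rnorm (u i))%:E | i in I]).

Definition convex_weights (n : nat) (c : 'I_n -> R) :=
  (forall j, 0 <= c j) /\ \sum_(j < n) c j = 1.

Definition lin_span (V : normedModType R[i]) (B : set V) : set V :=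
  [set v | exists (n : nat) (c : 'I_n -> R[i]) (w : 'I_n -> V),
    (forall j, B (w j)) /\ v = \sum_(j < n) c j *: w j].

End Operators.

Section Nets.
Variables (D : Type) (le : D -> D -> Prop).

Definition directed :=
  [/\ exists a : D, True, forall a, le a a,
      forall a b c, le a b -> le b c -> le a c
    & forall a b, exists c, le a c /\ le b c].

Definition tails : set_system D := filter_from setT (fun a => [set b | le a b]).

End Nets.

Section Representations.
Variables (R : realType) (G : semitopologicalSemigroupType).

Definition representation (V : normedModType R[i]) (S : G -> V -> V) :=
  [/\ forall g, is_operator (S g),
      forall g1 g2 v, S g1 (S g2 v) = S (g2 * g1)%g v
    & forall v, continuous (fun g => S g v)].

Definition markov_operator (K : topologicalType) (T : C[R](K) -> C[R](K)) :=
  (forall f : C[R](K), (forall x, 0 <= f x :> R[i]) ->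
    forall x, 0 <= T f x :> R[i])
  /\ T bcone = bcone.

Definition twist (V : normedModType R[i]) (chi : G -> Cplx R) (S : G -> V -> V) :
  G -> V -> V := fun g v => chi g *: S g v.

(* Uniform convergence on compact sets is the topology carried by the ambient
   function space {family compact, G -> Cplx R}. *)
Definition dual_semigroup : set {family compact, G -> Cplx R} :=
  [set chi | [/\ continuous (chi : G -> Cplx R),
    forall g h, chi (g * h)%g = chi g * chi h & forall g, `|chi g| = 1]].

Section UniformFamily.
Variables (V : normedModType R[i]) (D : Type) (le : D -> D -> Prop).
Variables (J : Type) (I : set J) (S : J -> G -> V -> V) (A : J -> D -> V -> V).

Definition uniform_right_ergodic :=
  [/\ forall i, I i -> representation (S i),
      (exists M : R, forall i g, I i -> (opnorm (S i g) <= M%:E)%E),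
      forall i a, I i -> is_operator (A i a),
      forall (a : D) (e : R) (m : nat) (f : 'I_m -> V), 0 < e ->
        exists (n : nat) (g : 'I_n -> G) (c : J -> 'I_n -> R),
          (forall i, I i -> convex_weights (c i)) /\
          forall k, (sup_norm I (fun i =>
            A i a (f k) - \sum_(j < n) (c i j)%:C *: S i (g j) (f k))%R
              < e%:E)%E
    & forall (g : G) (f : V),
        sup_norm I (fun i => A i a f - A i a (S i g f)) @[a --> tails le]
          --> 0%:E].

End UniformFamily.

End Representations.

Section RightAmenable.
Variables (R : realType) (V : normedModType R[i]).

(* {ptws V -> V} carries the topology of pointwise convergence, which induces
   the strong operator topology. The function F' is F( . T). *)
Definition right_invariant_mean (SS : set {ptws V -> V})
    (m : C_b[R](SS) -> Cplx R) :=
  [/\ is_operator m, m bcone = 1, opnorm m = 1%E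
    & forall (T : SS) (F F' : C_b[R](SS)),
        (forall U UT : SS, set_val UT = set_val U \o set_val T :> (V -> V) ->
          F' U = F UT) ->
        m F' = m F].

Definition right_amenable (SS : set {ptws V -> V}) :=
  exists m, @right_invariant_mean SS m.

End RightAmenable.

Section MeanErgodic.
Variables (R : realType) (G : Type) (V : normedModType R[i]).
Implicit Types (T : G -> V -> V) (Y : set V).

Definition orbit_space T (f : V) : set V :=
  closure (lin_span (range (fun g => T g f))).

Definition convex_ops T : set (V -> V) :=
  [set U | exists (n : nat) (c : 'I_n -> R) (g : 'I_n -> G),
    convex_weights c /\ U = fun v => \sum_(j < n) (c j)%:C *: T (g j) v].

(* Operators on the subspace Y are represented by functions on V, whose values
   outside of Y are irrelevant. *)
Definition is_operator_on Y (P : V -> V) :=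
  [/\ forall y, Y y -> Y (P y),
      forall (a : R[i]) y z, Y y -> Y z -> P (a *: y + z) = a *: P y + P z
    & {within Y, continuous P}].

(* sigL Y P is the restriction of P to the subtype Y. *)
Definition closed_convex_ops_on Y T : set (V -> V) :=
  [set P | is_operator_on Y P /\
    closure [set (sigL Y U : {ptws Y -> V}) | U in convex_ops T]
      (sigL Y P : {ptws Y -> V})].

Definition mean_ergodic_projection Y T (P : V -> V) :=
  closed_convex_ops_on Y T P /\
  forall U, closed_convex_ops_on Y T U ->
    forall y, Y y -> P (U y) = P y /\ U (P y) = P y.

(* p is the value at f of the mean ergodic projection of T on the closed linear
   span Y of the orbit of f. Since f itself may lie outside of Y, that value is
   then by convention P (T g f), for some (equivalently, any) g. *)
Definition mean_ergodic_value T (f p : V) :=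
  let Y := orbit_space T f in
  exists P, [/\ mean_ergodic_projection Y T P, Y f -> p = P f
    & ~ Y f -> exists g, p = P (T g f)].

End MeanErgodic.

(* The library's measurable types are pointed; K is nonempty anyway since it
   carries a probability measure. *)
Definition borel (K : ptopologicalType) := g_sigma_algebraType (@open K).

Section InvariantMeasure.
Variables (R : realType) (K : ptopologicalType).
Variable mu : probability (borel K) R.
Implicit Types u v w : K -> Cplx R.

Definition regular_measure :=
  forall (B : set (borel K)) (e : R), measurable B -> 0 < e ->
    exists F U : set K, [/\ closed F, open U, F `<=` B, B `<=` U
      & (mu (U `\` F) < e%:E)%E].

Definition cintegral u : R[i] :=
  (\int[mu]_x complex.Re (u x)) +i* (\int[mu]_x complex.Im (u x)).

(* nu ranges over the dual of C(K), and c * mu acts on it by integration. *)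
Definition uniquely_ergodic (I : Type) (S : I -> C[R](K) -> C[R](K)) :=
  forall nu : C[R](K) -> Cplx R, is_operator nu ->
    (forall g f, nu (S g f) = nu f) <->
    exists c : R[i], forall f, nu f = c * cintegral f.

(* Elements of L^2(K, mu) are represented by functions, identified up to eq_mu;
   the library's L^p spaces are those of real-valued functions. *)
Definition L2 : set (K -> Cplx R) :=
  [set u | (fun x => complex.Re (u x)) \in Lfun mu 2%:E /\
           (fun x => complex.Im (u x)) \in Lfun mu 2%:E].

Definition L2dot u v : R[i] := cintegral (fun x => u x * (v x)^*).

Definition L2norm u : R := Num.sqrt (complex.Re (L2dot u u)).

Definition eq_mu u v := {ae mu, forall x : borel K, u x = v x}.

(* T2 induces a bounded linear operator on L^2(K, mu) that extends T; linearity
   and boundedness make it compatible with eq_mu. *)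
Definition L2_extension (T : C[R](K) -> C[R](K))
    (T2 : (K -> Cplx R) -> (K -> Cplx R)) :=
  [/\ forall u, L2 u -> L2 (T2 u),
      forall (a : R[i]) u v, L2 u -> L2 v ->
        eq_mu (T2 (fun x => a * u x + v x)) (fun x => a * T2 u x + T2 v x),
      exists M : R, forall u, L2 u -> L2norm (T2 u) <= M * L2norm u
    & forall f : C[R](K), eq_mu (T2 f) (T f)].

Definition Fix_L2 (I : Type) (chi : I -> Cplx R)
    (S2 : I -> (K -> Cplx R) -> (K -> Cplx R)) : set (K -> Cplx R) :=
  [set u | L2 u /\ forall g, eq_mu (fun x => chi g * S2 g u x) u].

Definition orthogonal_projection (M : set (K -> Cplx R)) u w :=
  M w /\ forall v, M v -> L2dot (fun x => u x - w x) v = 0.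

End InvariantMeasure.

(* Main.v *)
Require Import Defs.
From mathcomp Require Import ring lra.

Set Implicit Arguments.
Unset Strict Implicit.
Unset Printing Implicit Defensive.

Import Order.TTheory GRing.Theory Num.Theory.
Import numFieldTopology.Exports numFieldNormedType.Exports.

Local Open Scope classical_set_scope.
Local Open Scope ring_scope.

(** Two facts about a mean ergodic value p of the orbit of f carry the proof: p
is fixed by the semigroup (mean_ergodic_value_fixed), and p is a norm limit of
convex combinations of the orbit of f (mean_ergodic_value_approx).

Let M bound all the operators of the family, and let s be a convex combination
of finitely many S_i(g_j) f, with rnorm (s - p_i) <= d. The operator A_i(a)
fixes p_i, since it is a limit of convex combinations of S_i, so that
<<
  A_i(a) f - p_i = (A_i(a) f - A_i(a) s) + A_i(a) (s - p_i).
>>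
The first term tends to 0 along a, by asymptotic invariance, and it does so
uniformly in i and in the weights of s, because only the finitely many g_j
matter; the second term is at most M d. This is asymptotically_near_fixed.

It is used twice. For one index i, with s close to p_i, it gives an index b of
the net with A_i(b) f close to p_i. By continuity of the norm, A_i'(b) f is then
close to p_i' for all i' near i. Now A_i'(b) f is itself close to a convex
combination of some S_i'(g_j) f, with the same g_j for all i', so the estimate
applies again and makes A_i'(a) f close to p_i' for all large a and all i' near
i. Compactness of the index set turns this local uniformity into a global one.
This is uniform_ergodic_convergence, which holds for compact families of
representations on any normed space; the theorem is its instance for the twists
of S by the characters in Lambda. *)

(** * Real-valued norms and convex combinations *)

Section NormedSpace.
Variables (R : realType) (V : normedModType R[i]).
Implicit Types u v w : V.

Lemma normrE v : `|v| = (rnorm v)%:C%C.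
Proof. by rewrite /rnorm RRe_real// normr_real. Qed.

Lemma rnorm_ge0 v : 0 <= rnorm v.
Proof. by rewrite -lecR -normrE normr_ge0. Qed.

Lemma rnorm0 : rnorm (0 : V) = 0.
Proof. by rewrite /rnorm normr0. Qed.

Lemma rnormN v : rnorm (- v) = rnorm v.
Proof. by rewrite /rnorm normrN. Qed.

Lemma rnormD u v : rnorm (u + v) <= rnorm u + rnorm v.
Proof. by rewrite -lecR rmorphD/= -!normrE ler_normD. Qed.

Lemma rnorm_distC u v : rnorm (u - v) = rnorm (v - u).
Proof. by rewrite -rnormN opprB. Qed.

Lemma rnorm_distD w u v : rnorm (u - v) <= rnorm (u - w) + rnorm (w - v).
Proof. by rewrite (le_trans _ (rnormD _ _))// addrA subrK. Qed.

Lemma rnormZ (c : R) v : 0 <= c -> rnorm (c%:C%C *: v) = c * rnorm v.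
Proof.
move=> c0; apply: (@complexI R).
by rewrite -normrE normrZ ger0_norm ?lecR// rmorphM/= -normrE.
Qed.

Lemma rnorm_eq0 v : rnorm v = 0 -> v = 0.
Proof. by move=> v0; apply/eqP; rewrite -normr_eq0 normrE v0. Qed.

Lemma rnorm_convex_comb n (c : 'I_n -> R) (w : 'I_n -> V) (b : R) :
  convex_weights c -> (forall j, rnorm (w j) <= b) ->
  rnorm (\sum_(j < n) (c j)%:C%C *: w j) <= b.
Proof.
move=> [c0 c1] wb; rewrite -[b]mul1r -c1 mulr_suml.
elim/big_rec2: _ => [|j x v _ vx]; first by rewrite rnorm0.
by rewrite (le_trans (rnormD _ _))// lerD// rnormZ// ler_wpM2l.
Qed.

Lemma convex_comb_cst n (c : 'I_n -> R) v :
  convex_weights c -> \sum_(j < n) (c j)%:C%C *: v = v.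
Proof.
move=> [_ c1]; rewrite -scaler_suml.
by rewrite -(rmorph_sum (real_complex R)) c1 scale1r.
Qed.

End NormedSpace.

(** * Linear maps and suprema of norms *)

Section Operator.
Variables (R : realType) (V W : normedModType R[i]) (T : V -> W).
Hypothesis T_linear : linear T.

Lemma operator0 : T 0 = 0.
Proof.
by have := T_linear (-1) 0 0; rewrite scaler0 addr0 scaleN1r addNr.
Qed.

Lemma operator_sum n (a : 'I_n -> R[i]) (w : 'I_n -> V) :
  T (\sum_(j < n) a j *: w j) = \sum_(j < n) a j *: T (w j).
Proof.
by elim/big_rec2: _ => [|j _ v _ <-]; [exact: operator0|exact: T_linear].
Qed.

Lemma operatorB v w : T (v - w) = T v - T w.
Proof. by rewrite addrC -scaleN1r T_linear scaleN1r addrC. Qed.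

Lemma operatorZ a v : T (a *: v) = a *: T v.
Proof. by rewrite -[a *: v]addr0 T_linear operator0 addr0. Qed.

Lemma rnorm_opnorm_le (M : R) v :
  (opnorm T <= M%:E)%E -> rnorm (T v) <= M * rnorm v.
Proof.
move=> TM; have [v0|v0] := eqVneq (rnorm v) 0.
  by rewrite (rnorm_eq0 v0) operator0 !rnorm0 mulr0.
have {}v0 : 0 < rnorm v by rewrite lt_neqAle eq_sym v0 rnorm_ge0.
have vi0 : 0 <= (rnorm v)^-1 by rewrite invr_ge0 ltW.
suff : rnorm (T ((rnorm v)^-1%:C%C *: v)) <= M.
  by rewrite operatorZ rnormZ// ler_pdivrMl// mulrC.
rewrite -lee_fin (le_trans _ TM)//; apply: ereal_sup_ubound.
by exists ((rnorm v)^-1%:C%C *: v) => //=; rewrite rnormZ// mulVf ?gt_eqF.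
Qed.

End Operator.

Section SupNorm.
Variables (R : realType) (J : Type) (I : set J) (V : normedModType R[i]).
Implicit Type u : J -> V.

Lemma le_sup_norm u i : I i -> ((rnorm (u i))%:E <= sup_norm I u)%E.
Proof. by move=> Ii; apply: ereal_sup_ubound; right; exists i. Qed.

Lemma sup_norm_le u (b : R) :
  0 <= b -> (forall i, I i -> rnorm (u i) <= b) -> (sup_norm I u <= b%:E)%E.
Proof.
move=> b0 ub; apply: ge_ereal_sup => _ [->|[i Ii <-]]; rewrite lee_fin//.
exact: ub.
Qed.

Lemma sup_norm_ge0 u : (0 <= sup_norm I u)%E.
Proof. by apply: ereal_sup_ubound; left. Qed.

End SupNorm.

Lemma tails_filter (D : Type) (le : D -> D -> Prop) :
  directed le -> Filter (tails le).
Proof.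
move=> [[a0 _] _ letr ledir]; apply: filter_from_filter; first by exists a0.
move=> a b _ _; have [c [ac bc]] := ledir a b; exists c => // d cd.
by split; [exact: letr ac cd|exact: letr bc cd].
Qed.

(** The supremum over I may be infinite for some a, so the convergence is reduced
to strict bounds on the terms, where real arithmetic applies. *)
Lemma sup_norm_cvg0P (R : realType) (J : Type) (I : set J)
    (V : normedModType R[i]) (T : Type) (F : set_system T) (FF : Filter F)
    (u : T -> J -> V) :
  sup_norm I (u a) @[a --> F] --> 0%:E <->
  forall e : R, 0 < e -> \forall a \near F, forall i, I i -> rnorm (u a i) < e.
Proof.
split=> [u0 e e0|u0].
  have : \forall a \near F, (sup_norm I (u a) < e%:E)%E.
    apply: (u0 [set x | (x < e%:E)%E]); apply: open_nbhs_nbhs.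
    split; first exact: open_ereal_lt_ereal.
    by rewrite /= lte_fin.
  apply: filterS => a ae i Ii.
  by rewrite -lte_fin (le_lt_trans (le_sup_norm _ Ii)).
move=> B B0; have /nbhs_ballP[e /= e0 eB] : nbhs (0 : R) [set r | B r%:E].
  exact: B0.
have e20 : 0 < e / 2 by rewrite divr_gt0.
rewrite /=; apply: filterS (u0 _ e20) => a ae.
have : (sup_norm I (u a) <= (e / 2)%:E)%E.
  by apply: sup_norm_le => [|i Ii]; rewrite ltW ?ae.
have := sup_norm_ge0 I (u a); rewrite /=.
case: (sup_norm I (u a)) => // r; rewrite !lee_fin => r0 re.
apply: eB; rewrite /ball/= sub0r normrN ger0_norm// (le_lt_trans re)//.
by rewrite ltr_pdivrMr// ltr_pMr// ltr1n.
Qed.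

(** * Values of mean ergodic projections *)

Section MeanErgodicValue.
Variables (R : realType) (G : semitopologicalSemigroupType).
Variables (V : normedModType R[i]) (T : G -> V -> V).
Hypothesis T_rep : representation T.

Lemma representation_linear g : linear (T g).
Proof. by have [/(_ g)[]] := T_rep. Qed.

Lemma orbit_space_invariant f g : orbit_space T f `<=` T g @^-1` orbit_space T f.
Proof.
have [Top Tmul _] := T_rep; have [lTg cTg] := Top g.
suff : lin_span (range (T^~ f)) `<=` T g @^-1` lin_span (range (T^~ f)).
  move=> sub v; rewrite /orbit_space => fv B /cTg /fv [w [/sub ? ?]].
  by exists (T g w).
move=> _ [n [c [w [wf ->]]]]; exists n, c, (T g \o w); split=> [j|] /=.
  by have [h _ <-] := wf j; exists (h * g)%g => //=; rewrite Tmul.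
by rewrite operator_sum.
Qed.

(** This makes T g one of the operators that the zero element P of the closed
convex hull absorbs, whence T g (P y) = P y. *)
Lemma closed_convex_ops_on_orbit f g :
  closed_convex_ops_on (orbit_space T f) T (T g).
Proof.
have [/(_ g)[lTg cTg] _ _] := T_rep; split.
  split; first exact: orbit_space_invariant.
  - by move=> a y z _ _; exact: lTg.
  - exact: continuous_subspaceT.
apply: subset_closure; exists (T g) => //; exists 1%N, (fun=> 1), (fun=> g).
split; first by split=> //; rewrite big_ord1.
by apply/funext => v; rewrite big_ord1 scale1r.
Qed.

Lemma orbit_in_orbit_space f g : orbit_space T f (T g f).
Proof.
apply: subset_closure; exists 1%N, (fun=> 1), (fun=> T g f).
by split=> [_|]; [exists g|rewrite big_ord1 scale1r].
Qed.

(** The closure is taken for pointwise convergence on Y, so evaluation at the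
point y of Y is continuous and sends it into the norm closure. *)
Lemma closed_convex_ops_approx (Y : set V) P y (e : R) :
  closed_convex_ops_on Y T P -> Y y -> 0 < e ->
  exists n (c : 'I_n -> R) (g : 'I_n -> G), convex_weights c /\
    rnorm (\sum_(j < n) (c j)%:C%C *: T (g j) y - P y) < e.
Proof.
move=> [_ clP] Yy e0.
pose y' : Y := exist _ y (mem_set Yy).
have := @proj_continuous Y (fun=> V) y' (sigL Y P).
have Bn : nbhs (P y) [set v | rnorm (v - P y) < e].
  apply/nbhs_ballP; exists e%:C%C => /=; first by rewrite ltcR.
  by move=> v; rewrite -ball_normE /= normrE ltcR rnorm_distC.
move=> /(_ _ Bn) /clP[_ [[U [n [c [g [cw ->]]]] <-] /= UB]].
by exists n, c, g.
Qed.

Lemma mean_ergodic_value_fixed f p g : mean_ergodic_value T f p -> T g p = p.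
Proof.
move=> [P [[_ zeroP] Yf nYf]].
have fixP y : orbit_space T f y -> T g (P y) = P y.
  by move=> Yy; have [] := zeroP _ (closed_convex_ops_on_orbit f g) _ Yy.
have [fY|/nYf[h ->]] := pselect (orbit_space T f f).
  by rewrite Yf// fixP.
by rewrite fixP//; exact: orbit_in_orbit_space.
Qed.

(** When f lies outside of its orbit space, the approximating combinations are
those of the orbit of T h f, which is part of the orbit of f. *)
Lemma mean_ergodic_value_approx f p (e : R) :
  mean_ergodic_value T f p -> 0 < e ->
  exists n (c : 'I_n -> R) (g : 'I_n -> G), convex_weights c /\
    rnorm (\sum_(j < n) (c j)%:C%C *: T (g j) f - p) < e.
Proof.
have [_ Tmul _] := T_rep.
move=> [P [[PT _] Yf nYf]] e0.
have [fY|/nYf[h ->]] := pselect (orbit_space T f f).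
  by rewrite Yf//; exact: closed_convex_ops_approx PT fY e0.
have [n [c [g [cw Pe]]]] :=
  closed_convex_ops_approx PT (@orbit_in_orbit_space f h) e0.
exists n, c, (fun j => (h * g j)%g); split=> //.
by under eq_bigr do rewrite -Tmul.
Qed.

End MeanErgodicValue.

(** * Uniform families of right ergodic nets *)

Section UniformFamily.
Variables (R : realType) (G : semitopologicalSemigroupType).
Variables (V : normedModType R[i]) (D : Type) (le : D -> D -> Prop).
Hypothesis le_directed : directed le.
Variables (J : Type) (I : set J) (S : J -> G -> V -> V) (A : J -> D -> V -> V).
Hypothesis A_ergodic : uniform_right_ergodic le I S A.

Let FD : Filter (tails le) := tails_filter le_directed.
#[local] Existing Instance FD.

Lemma uniform_approx a f (e : R) : 0 < e ->
  exists n (g : 'I_n -> G) (c : J -> 'I_n -> R),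
    (forall i, I i -> convex_weights (c i)) /\
    forall i, I i ->
      rnorm (A i a f - \sum_(j < n) (c i j)%:C%C *: S i (g j) f) < e.
Proof.
move=> e0; have [_ _ _ + _] := A_ergodic.
move=> /(_ a e 1%N (fun=> f) e0)[n [g [c [cw /(_ ord0) Ae]]]].
exists n, g, c; split=> // i Ii.
by rewrite -lte_fin (le_lt_trans _ Ae)//; exact: (le_sup_norm _ Ii).
Qed.

(** Each value of A i a is a limit of convex combinations of values of S i, and
thus inherits the uniform bound on the operators S i g. *)
Lemma uniformly_bounded : exists2 M : R, 0 <= M &
  forall i a f, I i -> rnorm (A i a f) <= M * rnorm f.
Proof.
have [Srep [M SM] _ _ _] := A_ergodic.
(* For an empty I the given bound may be negative. *)
exists (Num.max M 0); first by rewrite le_max lexx orbT.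
move=> i a f Ii; apply/ler_addgt0Pr => e e0.
have [n [g [c [cw /(_ i Ii) Ae]]]] := uniform_approx a f e0.
set s := \sum_(j < n) _ in Ae.
rewrite -(subrK s (A i a f)) (le_trans (rnormD _ _))// [leRHS]addrC.
apply: lerD; first exact: ltW.
apply: rnorm_convex_comb => [|j]; first exact: cw.
rewrite (le_trans (rnorm_opnorm_le _ _ (SM i (g j) Ii)))//.
  exact: representation_linear (Srep i Ii) _.
by rewrite ler_wpM2r ?rnorm_ge0// le_max lexx.
Qed.

Lemma fixed_ergodic_net i a p : I i -> (forall g, S i g p = p) -> A i a p = p.
Proof.
move=> Ii fixp; apply/eqP; rewrite -subr_eq0; apply/eqP/rnorm_eq0/le_anti.
rewrite rnorm_ge0 andbT; apply/ler_addgt0Pr => e e0.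
have [n [g [c [cw /(_ i Ii)]]]] := uniform_approx a p e0.
under eq_bigr do rewrite fixp.
by rewrite add0r convex_comb_cst => [/ltW//|]; exact: cw.
Qed.

(** The estimate is uniform in i, in the weights c and in the fixed point p: the
tail of the net depends only on f, e and the elements g_j. *)
Lemma asymptotically_near_fixed (M : R) n (g : 'I_n -> G) f (d e : R) :
  0 <= M -> (forall i a v, I i -> rnorm (A i a v) <= M * rnorm v) -> 0 < e ->
  \forall a \near tails le, forall i (c : 'I_n -> R) p, I i ->
    convex_weights c -> (forall h, S i h p = p) ->
    rnorm (\sum_(j < n) (c j)%:C%C *: S i (g j) f - p) <= d ->
    rnorm (A i a f - p) <= e + M * d.
Proof.
move=> M0 AM e0; have [_ _ Aop _ Ainv] := A_ergodic.
have : \forall a \near tails le, forall j, forall i, I i ->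
    rnorm (A i a f - A i a (S i (g j) f)) < e.
  by apply: filter_forall => j; exact: (proj1 (sup_norm_cvg0P _ _ _)).
apply: filterS => a Ae i c p Ii cw fixp fd; have [lA _] := Aop i a Ii.
set s := \sum_(j < n) _ in fd.
rewrite (le_trans (rnorm_distD (A i a s) _ _))// lerD//.
  rewrite -{1}(convex_comb_cst f cw) /s !(operator_sum lA) -sumrB.
  under eq_bigr do rewrite -scalerBr.
  by apply: rnorm_convex_comb => // j; rewrite ltW// Ae.
rewrite -{1}(fixed_ergodic_net a Ii fixp) -(operatorB lA).
by rewrite (le_trans (AM _ _ _ Ii))// ler_wpM2l.
Qed.

End UniformFamily.

(** A compact set satisfies the near-covering property: what holds for all a in
a tail and all i' in a neighbourhood of each point of I holds for all a in a
single tail and all points of I. This replaces the extraction of a finite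
subcover. *)
Theorem uniform_ergodic_convergence (R : realType)
    (G : semitopologicalSemigroupType) (V : normedModType R[i])
    (D : Type) (le : D -> D -> Prop) (le_directed : directed le)
    (J : topologicalType) (I : set J) (I_compact : compact I)
    (S : J -> G -> V -> V) (A : J -> D -> V -> V)
    (A_ergodic : uniform_right_ergodic le I S A) (f : V) (p : J -> V)
    (p_fixed : forall i g, I i -> S i g (p i) = p i)
    (p_approx : forall i (e : R), I i -> 0 < e ->
      exists n (c : 'I_n -> R) (g : 'I_n -> G), convex_weights c /\
        rnorm (\sum_(j < n) (c j)%:C%C *: S i (g j) f - p i) < e)
    (norm_continuous : forall a,
      {within I, continuous (fun i => rnorm (A i a f - p i) : R)}) :
  sup_norm I (fun i => A i a f - p i) @[a --> tails le] --> 0%:E.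
Proof.
have FD := tails_filter le_directed.
have [M M0 AM] := uniformly_bounded A_ergodic.
apply/sup_norm_cvg0P => e e0.
(* The factor 2 comes from the local step below: A_i'(b) f is within d both of
   p_i' and of a convex combination s, so s is within 2 d of p_i'. *)
have shrink (x : R) : 0 < x -> exists2 d, 0 < d & d + M * (2 * d) < x.
  move=> x0; have M2 : 0 < 2 * (1 + M) by lra.
  exists (x / (2 * (1 + M))); first by rewrite divr_gt0.
  rewrite [ltLHS] (_ : _ = x - x / (2 * (1 + M))); last by field; lra.
  by rewrite gtrBl divr_gt0.
have [d d0 de] := shrink _ e0.
move/compact_near_coveringP/near_covering_withinP: I_compact; apply=> // i Ii.
have [b ib] : exists b, rnorm (A i b f - p i) < d.
  have [d' d'0 d'd] := shrink _ d0.
  have d'2 : 0 < 2 * d' by rewrite mulr_gt0.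
  have [n [c [g [cw gp]]]] := p_approx _ _ Ii d'2.
  have [b _ bP] := asymptotically_near_fixed le_directed A_ergodic g f
    (2 * d') M0 AM d'0.
  exists b; apply: le_lt_trans d'd.
  apply: (bP b _ i c) => //; first by have [_ + _ _] := le_directed; apply.
    by move=> h; exact: p_fixed.
  exact: ltW.
have [n [g [c [cw bg]]]] := uniform_approx A_ergodic b f d0.
(* The neighbourhood comes from the continuity of the norm at the fixed index b,
   the tail from the finitely many g_j that approximate at b all over I. *)
exists ([set i' | I i' -> rnorm (A i' b f - p i') < d],
  [set a | forall i' (c' : 'I_n -> R) q, I i' -> convex_weights c' ->
    (forall h, S i' h q = q) ->
    rnorm (\sum_(j < n) (c' j)%:C%C *: S i' (g j) f - q) <= 2 * d ->
    rnorm (A i' a f - q) <= d + M * (2 * d)]) => /=.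
  split; last exact: asymptotically_near_fixed.
  have /subspace_continuousP/(_ i Ii)/cvgr_lt/(_ _ ib) := norm_continuous b.
  by [].
move=> [i' a] /= [ib' aP] Ii'; apply: le_lt_trans de.
apply: (aP i' (c i')) => // [|h|]; [exact: cw|exact: p_fixed|].
rewrite (le_trans (rnorm_distD (A i' b f) _ _))// rnorm_distC mulr2n mulrDl.
by rewrite mul1r lerD// ltW ?ib' ?bg.
Qed.

Theorem corollary1p12 (R : realType) (K : ptopologicalType)
    (K_compact : compact [set: K]) (K_hausdorff : hausdorff_space K)
    (G : semitopologicalSemigroupType)
    (S : G -> C[R](K) -> C[R](K))
    (S_rep : representation S) (S_markov : forall g, markov_operator (S g))
    (S_amenable : right_amenable (range S))
    (mu : probability (borel K) R) (mu_regular : regular_measure mu)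
    (S_ue : uniquely_ergodic mu S)
    (S2 : G -> (K -> Cplx R) -> (K -> Cplx R))
    (S2_ext : forall g, L2_extension mu (S g) (S2 g))
    (Lambda : set {family compact, G -> Cplx R})
    (Lambda_dual : Lambda `<=` @dual_semigroup R G)
    (Lambda_compact : compact Lambda)
    (D : Type) (le : D -> D -> Prop) (le_directed : directed le)
    (A : {family compact, G -> Cplx R} -> D -> C[R](K) -> C[R](K))
    (A_ergodic :
      uniform_right_ergodic le Lambda (fun chi => twist chi S) A)
    (f : C[R](K))
    (p : {family compact, G -> Cplx R} -> C[R](K))
    (p_value : forall chi, Lambda chi ->
      mean_ergodic_value (twist chi S) f (p chi))
    (proj_continuous : forall chi, Lambda chi -> exists h : C[R](K),
      orthogonal_projection mu (Fix_L2 mu chi S2) f h)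
    (norm_continuous : forall a,
      {within Lambda, continuous (fun chi => rnorm (A chi a f - p chi) : R)}) :
  sup_norm Lambda (fun chi => A chi a f - p chi) @[a --> tails le] --> 0%:E.
Proof.
have [T_rep _ _ _ _] := A_ergodic.
apply: (uniform_ergodic_convergence _ _ A_ergodic) => //.
- move=> chi g Lchi.
  by apply: (mean_ergodic_value_fixed (T_rep _ Lchi)); exact: p_value.
- move=> chi e Lchi.
  by apply: (mean_ergodic_value_approx (T_rep _ Lchi)); exact: p_value.
Qed.
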